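(* Let $\hat{\mathcal G}=(\mathcal V,\hat{\mathcal E})$ be a connected graph with positive line susceptances. Suppose a critical edge $\ell=(i,j)\in\hat{\mathcal E}$, with $i,j\in\mathcal V_r$, partitions the nodes of $\hat{\mathcal G}$ into two disjoint connected components (the components of $\hat{\mathcal G}$ with $\ell$ removed): a set $\mathcal V_\ell$ and its complement $\bar{\mathcal V}_\ell$, where $\mathcal V_\ell$ contains nodes $i$ and $1$, and $\bar{\mathcal V}_\ell$ contains node $j$. Let $z\in\{0,1\}^{|\hat{\mathcal E}|}$ and $X$ satisfy $\tilde L(z)X=I_N$. Then for every $\epsilon>0$: (1) $$\frac{[\tilde L_f^{-1}]_{ii}+[\tilde L_f^{-1}]_{jj}-\hat d_{ij}-\epsilon}{2}\ \le\ X_{ij},$$ where $\hat d_{ij}$ is the length of the shortest path between $i$ and $j$ on $\hat{\mathcal G}$ (the reactance of edge $\ell$). (2) If moreover the designed network is radial, i.e. the graph $(\mathcal V,\{\ell'\in\hat{\mathcal E}:z_{\ell'}=1\})$ is a tree, then $$\hat d_{i1}-\epsilon\ \le\ X_{ij},$$ where $\hat d_{i1}$ is the length of the shortest path between $i$ and the reference node $1$ on $\hat{\mathcal G}$.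
   Context: The node set is $\mathcal V=\{1,\dots,N+1\}$, node $1$ is the reference node, and $\mathcal V_r=\mathcal V\setminus\{1\}$; $N\times N$ matrices and vectors of length $N$ are indexed by $\mathcal V_r$. Graphs are undirected; each line $(i,j)\in\hat{\mathcal E}$ has susceptance $b_{ij}>0$ and reactance $x_{ij}=b_{ij}^{-1}$, and path lengths are measured by the sum of the reactances of their lines. For $i\in\mathcal V_r$ let $e_i\in\mathbb R^N$ be the canonical vector, with $e_1=0$ for the reference node; for a line $(i,j)$ let $a_{ij}=e_i-e_j$. For a binary line-selection vector $z$ (with $z_\ell=1$ iff line $\ell$ is selected), the reduced susceptance Laplacian is $\tilde L(z)=\sum_{(i,j)\in\hat{\mathcal E}}z_{ij}b_{ij}a_{ij}a_{ij}^\top$. The matrix $\tilde L_f=\sum_{(i,j)\in\hat{\mathcal E}}b_{ij}a_{ij}a_{ij}^\top$ is the reduced Laplacian with all candidate lines selected. An edge $\ell\in\hat{\mathcal E}$ is critical if $\hat{\mathcal G}$ becomes disconnected upon removing $\ell$. *)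

(* Defs.v *)
From HB Require Import structures.
From mathcomp Require Import all_boot all_order all_algebra.

Set Implicit Arguments.
Unset Strict Implicit.
Unset Printing Implicit Defensive.

Import Order.TTheory GRing.Theory Num.Theory.
Local Open Scope ring_scope.

(* A simple undirected graph on V is given by its edge set E : {set {set V}}, *)
(* every edge being the pair of its two distinct end nodes.                   *)
Section Graphs.

Variable V : finType.
Implicit Types (E : {set {set V}}) (u v : V) (p : seq V).

Definition simple_graph E := forall l, l \in E -> #|l| = 2.

Definition adj E : rel V := fun u v => [set u; v] \in E.

Definition connected_graph E := forall u v, connect (adj E) u v.

Definition components E : {set {set V}} :=
  equivalence_partition (connect (adj E)) [set: V].

Definition critical E (l : {set V}) := l \in E /\ ~ connected_graph (E :\ l).

(* Cycles of size 2 are excluded: u, v, u walks back and forth on one edge. *)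
Definition tree E :=
  connected_graph E /\
  forall c : seq V, (2 < size c)%N -> ucycle (adj E) c -> False.

(* The path visiting u and then the nodes of p. *)
Definition simple_path E u v p :=
  [&& path (adj E) u p, last u p == v & uniq (u :: p)].

Variable R : realFieldType.
Implicit Type b : {set V} -> R.

Definition path_length b u p : R :=
  \sum_(l <- pairmap (fun x y => [set x; y]) u p) (b l)^-1.

(* Simple paths from u have at most #|V| further nodes, hence range over a    *)
(* finite type. The value is 0 if v cannot be reached from u.                 *)
Definition dist E b u v : R :=
  if [pick p : #|V|.-bseq V | simple_path E u v p] is Some p0 then
    path_length b u
      [arg min_(p < p0 | simple_path E u v p) path_length b u p]%O
  else 0.

Lemma dist_le E b u v p : simple_path E u v p -> dist E b u v <= path_length b u p.
Proof.
move=> sp; have szp : (size p <= #|V|)%N.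
  case/and3P: sp => _ _ /= /andP[_ Up].
  by rewrite -(card_uniqP Up) max_card.
rewrite /dist; case: pickP => [p0 sp0|/(_ (Bseq szp))]; last by rewrite sp.
by case: arg_minP => // q _ /(_ (Bseq szp) sp).
Qed.

Lemma dist_attained E b u v : connect (adj E) u v ->
  exists2 p, simple_path E u v p & dist E b u v = path_length b u p.
Proof.
case/connectP=> p /shortenP[q eq_q Uq _] ->.
have sq : simple_path E u (last u q) q by rewrite /simple_path eq_q eqxx Uq.
have szq : (size q <= #|V|)%N.
  by case/andP: Uq => _ Uq; rewrite -(card_uniqP Uq) max_card.
rewrite /dist; case: pickP => [p0 sp0|/(_ (Bseq szq))]; last by rewrite sq.
by case: arg_minP => // r sr _; exists r.
Qed.

Lemma adj_sym E : symmetric (adj E).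
Proof. by move=> u v; rewrite /adj setUC. Qed.

Lemma critical_disconnects E u v : connected_graph E ->
  critical E [set u; v] -> ~~ connect (adj (E :\ [set u; v])) u v.
Proof.
move=> cE [_ nc]; apply/negP=> cuv; apply: nc => x y.
have cs := sym_connect_sym (adj_sym (E :\ [set u; v])).
apply: connect_sub (cE x y) => {}x {}y; rewrite /adj => exy.
have [eq_xy|ne_xy] := eqVneq [set x; y] [set u; v]; last first.
  by apply: connect1; rewrite /adj in_setD1 ne_xy.
have: x \in [set u; v] by rewrite -eq_xy set21.
have: y \in [set u; v] by rewrite -eq_xy set22.
by rewrite !inE => /orP[]/eqP-> /orP[]/eqP->; rewrite ?connect0 // cs.
Qed.

Lemma dist_critical E b u v : simple_graph E -> connected_graph E ->
    (forall l, l \in E -> 0 < b l) -> critical E [set u; v] ->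
  dist E b u v = (b [set u; v])^-1.
Proof.
move=> sE cE b_gt0 crit; have [lE _] := crit.
have ne_uv : u != v by have := sE _ lE; rewrite cards2; case: eqP.
apply/le_anti/andP; split.
  have sp : simple_path E u v [:: v].
    by rewrite /simple_path /= /adj lE eqxx inE ne_uv.
  by rewrite (le_trans (dist_le b sp)) // /path_length /= big_seq1.
have [p /and3P[pE /eqP lp _] ->] := dist_attained b (cE u v).
have steps x q : path (adj E) x q ->
    all (mem E) (pairmap (fun x y => [set x; y]) x q).
  by elim: q x => //= y q IH x /andP[exy /IH->]; rewrite andbT.
have avoid x q : path (adj E) x q ->
    [set u; v] \notin pairmap (fun x y => [set x; y]) x q ->
    path (adj (E :\ [set u; v])) x q.
  elim: q x => //= y q IH x /andP[exy pq]; rewrite inE negb_or => /andP[ne nq].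
  by rewrite IH // /adj in_setD1 eq_sym ne [_ \in E]exy.
have lp_in : [set u; v] \in pairmap (fun x y => [set x; y]) u p.
  apply: contraT => /(avoid _ _ pE) pD.
  by have /negP[] := critical_disconnects cE crit; apply/connectP; exists p.
rewrite /path_length (big_rem _ lp_in) /= lerDl big_seq sumr_ge0 // => l.
by move=> /mem_rem /(allP (steps _ _ pE)) /b_gt0 bl; rewrite invr_ge0 ltW.
Qed.

End Graphs.

Section Laplacian.

Variables (R : realFieldType) (N : nat).
Local Notation node := 'I_N.+1.
Implicit Types (E : {set {set node}}) (b : {set node} -> R).

(* The reference node is ord0; the index k : 'I_N of a reduced vector or      *)
(* matrix stands for the node lift ord0 k. Hence node_vec ord0 = 0.           *)
Definition node_vec (u : node) : 'cV[R]_N := \col_k (lift ord0 k == u)%:R.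

Definition line_vec (u v : node) : 'cV[R]_N := node_vec u - node_vec v.

(* Each line {u, v} is counted once, with the orientation u < v;              *)
(* line_vec u v *m (line_vec u v)^T does not depend on the orientation.       *)
Definition reduced_laplacian E b (z : {set node} -> bool) : 'M[R]_N :=
  \sum_(u : node) \sum_(v : node | (u < v)%N && ([set u; v] \in E))
    ((z [set u; v])%:R * b [set u; v]) *: (line_vec u v *m (line_vec u v)^T).

Definition full_laplacian E b : 'M[R]_N :=
  \sum_(u : node) \sum_(v : node | (u < v)%N && ([set u; v] \in E))
    b [set u; v] *: (line_vec u v *m (line_vec u v)^T).

End Laplacian.

(* Main.v *)
(* A line l = {u, v} is the only line across a cut S that avoids the reference
   node, so the indicator vector w of S satisfies L w = +- z_l b_l (e_u - e_v).
   If X inverts L, this forces z_l = 1, and reading X (e_u - e_v) = +- w / b_l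
   entrywise gives X_ij = X_ii for the critical line (i, j), and X_vv - X_uu =
   1 / b_l whenever u is on the reference side of l. Part (1) then reduces to
   the monotonicity of the diagonal of the inverse Laplacian when lines are
   removed; part (2) follows by adding up 1 / b_l along the tree path from i to
   the reference node, all of whose lines are cuts. *)
Require Import Defs.
From HB Require Import structures.
From mathcomp Require Import all_boot all_order all_algebra.
From mathcomp Require Import lra.
Import Order.TTheory GRing.Theory Num.Theory.
Local Open Scope ring_scope.

(** * Paths, trees and edge cuts *)

Section Cuts.

Context {V : finType}.
Implicit Types (E : {set {set V}}) (u v x y : V).

Lemma adj_neq E u v : simple_graph E -> adj E u v -> u != v.
Proof. by move=> sE /sE; rewrite cards2; case: eqP. Qed.

(** Every edge of such a path has both ends different from [u]. Hence the rest of a simple path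
    survives the removal of its first edge. *)
Lemma path_avoid E u v x p : path (adj E) x p -> u \notin x :: p ->
  path (adj (E :\ [set u; v])) x p.
Proof.
elim: p x => //= y p IH x /andP[exy pE]; rewrite inE negb_or => /andP[ux up].
rewrite IH // andbT /adj in_setD1 [_ \in E]exy andbT.
apply: contraNneq up => eq_l.
have : u \in [set x; y] by rewrite eq_l set21.
by rewrite !inE (negPf ux) /= => ->.
Qed.

(** A simple path from [u] to [v] that bypasses the edge would close up with it into a cycle. *)
Lemma tree_edge_cut E u v : simple_graph E -> tree E -> adj E u v ->
  ~~ connect (adj (E :\ [set u; v])) u v.
Proof.
move=> sE [_ acyc] euv; have ne_uv := adj_neq _ _ _ sE euv.
apply/negP=> /connectP[p /shortenP[q qD Uq _] lq].
(* A cycle needs three nodes: an empty [q] would give [u = v], and a one-node [q] would use the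
   removed edge. *)
have [szq|szq] := leqP (size q) 1.
  move: q szq qD lq {Uq} => [|y [|//]] _ /=.
    by move=> _ eq_vu; rewrite eq_vu eqxx in ne_uv.
  by rewrite andbT => euy eq_y; move: euy; rewrite /adj eq_y in_setD1 eqxx.
apply: (acyc (u :: q)) => //; rewrite /ucycle Uq andbT /= rcons_path -lq adj_sym.
rewrite euv andbT; apply: sub_path qD => x y.
by rewrite /adj in_setD1 => /andP[].
Qed.

Lemma component_closed E l x y u : [set x; y] \in E -> [set x; y] != l ->
  (x \in [set s | connect (adj (E :\ l)) u s])
    = (y \in [set s | connect (adj (E :\ l)) u s]).
Proof.
move=> exy ne_l; rewrite !inE.
apply: (same_connect_r (sym_connect_sym (@adj_sym _ _))).
by apply: connect1; rewrite /adj in_setD1 ne_l.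
Qed.

End Cuts.

Lemma mulmx_inj_unit {F : fieldType} {n} (A : 'M[F]_n) :
  (forall x : 'cV_n, A *m x = 0 -> x = 0) -> A \in unitmx.
Proof.
move=> injA; rewrite -unitmx_tr -row_free_unit; apply: inj_row_free => v vA.
by apply/trmx_inj; rewrite trmx0; apply: injA; rewrite -[A]trmxK -trmx_mul vA trmx0.
Qed.

(** * Node potentials and the Laplacian as a quadratic form *)

Section LaplacianTheory.

Context {R : realFieldType} {N : nat}.
Local Notation node := 'I_N.+1.
Implicit Types (E : {set {set node}}) (b : {set node} -> R).
Implicit Types (S : {set node}) (z : {set node} -> bool) (x y : 'cV[R]_N) (u v s : node).

(* The node potential of x, with potential 0 at the reference node. *)
Definition potential x u : R := ((node_vec R u)^T *m x) 0 0.

Lemma node_vec0 : node_vec R (ord0 : node) = 0.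
Proof. by apply/colP=> k; rewrite !mxE eq_sym (negPf (neq_lift _ _)). Qed.

Lemma node_vec_lift (k : 'I_N) : node_vec R (lift ord0 k) = delta_mx k 0.
Proof. by apply/colP=> m; rewrite !mxE (inj_eq lift_inj) eqxx andbT. Qed.

Lemma potential0 x : potential x ord0 = 0.
Proof. by rewrite /potential node_vec0 trmx0 mul0mx mxE. Qed.

Lemma potential_lift x k : potential x (lift ord0 k) = x k 0.
Proof. by rewrite /potential node_vec_lift trmx_delta -rowE mxE. Qed.

Lemma potentialZ a x u : potential (a *: x) u = a * potential x u.
Proof. by rewrite /potential -scalemxAr mxE. Qed.

Lemma potentialB x y u : potential (x - y) u = potential x u - potential y u.
Proof. by rewrite /potential mulmxBr !mxE. Qed.

Lemma tr_line_vecM u v x :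
  (line_vec R u v)^T *m x = (potential x u - potential x v)%:M.
Proof.
by rewrite [LHS]mx11_scalar /line_vec linearB /= mulmxBl mxE [X in _ + X]mxE.
Qed.

Lemma trM_line_vec u v x :
  x^T *m line_vec R u v = (potential x u - potential x v)%:M.
Proof. by rewrite -[LHS]trmxK trmx_mul trmxK tr_line_vecM tr_scalar_mx. Qed.

Lemma full_laplacianE E b : full_laplacian E b = reduced_laplacian E b xpredT.
Proof.
by apply: eq_bigr => u _; apply: eq_bigr => v _; rewrite mul1r.
Qed.

(** The coefficient of each line is the flow that the potentials [x] drive through it. *)
Lemma reduced_laplacianM E b z x : reduced_laplacian E b z *m x =
  \sum_(u : node) \sum_(v : node | (u < v)%N && ([set u; v] \in E))
    ((z [set u; v])%:R * b [set u; v] * (potential x u - potential x v))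
      *: line_vec R u v.
Proof.
rewrite mulmx_suml; apply: eq_bigr => u _.
rewrite mulmx_suml; apply: eq_bigr => v _.
by rewrite -scalemxAl -mulmxA tr_line_vecM mul_mx_scalar scalerA.
Qed.

Lemma reduced_laplacian_form E b z x :
  (x^T *m (reduced_laplacian E b z *m x)) 0 0 =
  \sum_(u : node) \sum_(v : node | (u < v)%N && ([set u; v] \in E))
    (z [set u; v])%:R * b [set u; v] * (potential x u - potential x v) ^+ 2.
Proof.
rewrite reduced_laplacianM mulmx_sumr summxE; apply: eq_bigr => u _.
rewrite mulmx_sumr summxE; apply: eq_bigr => v _.
by rewrite -scalemxAr mxE trM_line_vec mxE eqxx expr2 mulrA.
Qed.

Lemma reduced_laplacian_tr E b z :
  (reduced_laplacian E b z)^T = reduced_laplacian E b z.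
Proof.
rewrite linear_sum; apply: eq_bigr => u _; rewrite linear_sum.
by apply: eq_bigr => v _; rewrite linearZ /= trmx_mul trmxK.
Qed.

Lemma right_inverse_tr (A B : 'M[R]_N) : A^T = A -> A *m B = 1%:M -> B^T = B.
Proof.
move=> symA AB.
have BA : B^T *m A = 1%:M by rewrite -{1}symA -trmx_mul AB trmx1.
by rewrite -[B^T]mulmx1 -AB mulmxA BA mul1mx.
Qed.

(** * The action of the Laplacian and of its inverse on cuts *)

Definition cut_vec S : 'cV[R]_N := \col_k (lift ord0 k \in S)%:R.

Lemma potential_cut S u : ord0 \notin S -> potential (cut_vec S) u = (u \in S)%:R.
Proof.
move=> S0; have [k ->|->] := unliftP ord0 u; first by rewrite potential_lift mxE.
by rewrite potential0 (negPf S0).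
Qed.

(** Only selected lines are constrained, so unselected lines may cross the cut of a tree edge.
    Whether [[set u; v]] is itself selected is left open; this is deduced from invertibility. *)
Definition crossed_once E z S u v :=
  forall x y : node, [set x; y] \in E -> z [set x; y] ->
    [set x; y] != [set u; v] -> (x \in S) = (y \in S).

Lemma laplacian_cut E b z S u v : ord0 \notin S -> u != v ->
    [set u; v] \in E -> crossed_once E z S u v ->
  reduced_laplacian E b z *m cut_vec S =
  ((z [set u; v])%:R * b [set u; v] * ((u \in S)%:R - (v \in S)%:R))
    *: line_vec R u v.
Proof.
(* Swapping [u] and [v] changes the sign of both [line_vec] and the difference of indicators, so the
   orientation stored in the sum may be assumed. *)
move=> S0; wlog lt_uv : u v / (u < v)%N => [IH|].
  move=> ne_uv uvE Suv; have [lt_uv|lt_vu|/val_inj eq_uv] := ltngtP u v.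
  - exact: IH.
  - rewrite -[line_vec R u v]opprB scalerN -scaleNr -mulrN opprB.
    have eq_l : [set u; v] = [set v; u] by rewrite setUC.
    by rewrite eq_l; apply: IH; rewrite -?eq_l 1?eq_sym // /crossed_once -eq_l.
  by rewrite eq_uv eqxx in ne_uv.
move=> ne_uv uvE Suv; rewrite reduced_laplacianM pair_big_dep /=.
rewrite (bigD1 (u, v)) /=; last by rewrite lt_uv.
rewrite !potential_cut // [X in _ + X]big1 ?addr0 // => -[x y] /=.
case/andP=> /andP[lt_xy xyE] ne_p; rewrite !potential_cut //.
case: (boolP (z [set x; y])) => [zxy|_]; last by rewrite !mul0r scale0r.
rewrite (Suv x y) ?subrr ?mulr0 ?scale0r //.
apply: contraNneq ne_p => eq_l.
have: x \in [set u; v] by rewrite -eq_l set21.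
have: y \in [set u; v] by rewrite -eq_l set22.
rewrite !inE => /orP[]/eqP eq_y /orP[]/eqP eq_x; subst => //.
- by rewrite ltnn in lt_xy.
- by rewrite ltnNge ltnW in lt_xy.
by rewrite ltnn in lt_xy.
Qed.

(* The entry of X at a pair of nodes, with zero row and column at the reference. *)
Definition node_entry (X : 'M[R]_N) s u : R := potential (X *m node_vec R u) s.

Lemma node_entry_lift X (k m : 'I_N) :
  node_entry X (lift ord0 k) (lift ord0 m) = X k m.
Proof. by rewrite /node_entry potential_lift node_vec_lift -colE mxE. Qed.

Lemma node_entry0 X : node_entry X ord0 ord0 = 0.
Proof. exact: potential0. Qed.

Lemma node_entryC X s u : X^T = X -> node_entry X s u = node_entry X u s.
Proof.
rewrite /node_entry /potential => symX; rewrite mulmxA -[in RHS]symX.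
suff -> : (node_vec R s)^T *m X *m node_vec R u
  = ((node_vec R u)^T *m (X^T *m node_vec R s))^T by rewrite mxE.
by rewrite !trmx_mul !trmxK.
Qed.

Lemma node_entry_cut E b z X S u v s :
    reduced_laplacian E b z *m X = 1%:M ->
    ord0 \notin S -> u != v -> [set u; v] \in E -> crossed_once E z S u v ->
    u \in S -> v \notin S ->
  (s \in S)%:R =
    (z [set u; v])%:R * b [set u; v] * (node_entry X s u - node_entry X s v).
Proof.
move=> LX S0 ne_uv uvE Suv uS vS.
rewrite -potential_cut // -[cut_vec S]mul1mx -(mulmx1C LX) -mulmxA.
rewrite (laplacian_cut _ _ _ _ _ _ S0 ne_uv uvE Suv) uS (negPf vS) subr0 mulr1.
by rewrite -scalemxAr potentialZ mulmxBr potentialB.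
Qed.

(** At [s = u] the identity of [node_entry_cut] has left side 1, so the line is selected and its
    susceptance is nonzero; one may then divide. *)
Lemma node_entry_cutB E b z X S u v s :
    reduced_laplacian E b z *m X = 1%:M ->
    ord0 \notin S -> u != v -> [set u; v] \in E -> crossed_once E z S u v ->
    u \in S -> v \notin S ->
  node_entry X s u - node_entry X s v = (s \in S)%:R / b [set u; v].
Proof.
move=> LX S0 ne_uv uvE Suv uS vS.
have cut t := node_entry_cut _ _ _ _ _ _ _ t LX S0 ne_uv uvE Suv uS vS.
have := cut u; rewrite uS => /eqP; rewrite eq_sym.
case: (z _) cut => cut; last by rewrite !mul0r eq_sym oner_eq0.
rewrite mul1r cut mul1r => /eqP h.
have b0 : b [set u; v] != 0.
  by apply: contra_eq_neq h => ->; rewrite mul0r eq_sym oner_neq0.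
by rewrite mulrAC divff // mul1r.
Qed.

(** Take [s = v] and [s = u] in [node_entry_cutB], and link the two by the symmetry of [X]. *)
Lemma node_entry_cut_diag E b z X S u v :
    reduced_laplacian E b z *m X = 1%:M ->
    ord0 \notin S -> u != v -> [set u; v] \in E -> crossed_once E z S u v ->
    u \in S -> v \notin S ->
  node_entry X v u = node_entry X v v
  /\ node_entry X u u = node_entry X v v + (b [set u; v])^-1.
Proof.
move=> LX S0 ne_uv uvE Suv uS vS.
have cut t := node_entry_cutB _ _ _ _ _ _ _ t LX S0 ne_uv uvE Suv uS vS.
have symX := right_inverse_tr _ _ (reduced_laplacian_tr _ _ _) LX.
have := cut v; rewrite (negPf vS) mul0r => /eqP; rewrite subr_eq0 => /eqP eq_v.
split=> //; apply/eqP; rewrite -eq_v addrC -subr_eq -(node_entryC _ u v symX).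
by rewrite cut uS mul1r.
Qed.

(** * Comparison with the full Laplacian *)

Section PositiveSusceptance.

Variables (E : {set {set node}}) (b : {set node} -> R).
Hypothesis b_gt0 : forall l, l \in E -> 0 < b l.

Lemma reduced_laplacian_le_full z x :
  (x^T *m (reduced_laplacian E b z *m x)) 0 0
    <= (x^T *m (full_laplacian E b *m x)) 0 0.
Proof.
rewrite full_laplacianE !reduced_laplacian_form.
apply: ler_sum => u _; apply: ler_sum => v /andP[_ /b_gt0/ltW b_ge0].
rewrite ler_wpM2r ?sqr_ge0 // ler_wpM2r //.
by case: (z _).
Qed.

Lemma reduced_laplacian_ge0 z x :
  0 <= (x^T *m (reduced_laplacian E b z *m x)) 0 0.
Proof.
rewrite reduced_laplacian_form.
apply: sumr_ge0 => u _; apply: sumr_ge0 => v /andP[_ /b_gt0/ltW b_ge0].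
by rewrite mulr_ge0 ?sqr_ge0 // mulr_ge0.
Qed.

(** A kernel vector of the full Laplacian has zero energy, so its potential is equal at both ends of
    every line. The reduced Laplacian then kills it too, and is injective because [X] inverts it. *)
Lemma full_laplacian_unit z X :
  reduced_laplacian E b z *m X = 1%:M -> full_laplacian E b \in unitmx.
Proof.
move=> LX; apply: mulmx_inj_unit => x Lx0.
suff Lz0 : reduced_laplacian E b z *m x = 0.
  by rewrite -[x]mul1mx -(mulmx1C LX) -mulmxA Lz0 mulmx0.
have /eqP := congr1 (fun A : 'cV_N => (x^T *m A) 0 0) Lx0.
rewrite full_laplacianE reduced_laplacian_form mulmx0 mxE pair_big_dep /=.
rewrite psumr_eq0 => [/allP pot_eq|[u v] /= /andP[_ /b_gt0/ltW b_ge0]]; last first.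
  by rewrite mul1r mulr_ge0 ?sqr_ge0.
rewrite reduced_laplacianM; apply: big1 => u _; apply: big1 => v uvE.
have := pot_eq (u, v); rewrite mem_index_enum uvE /= mul1r => /(_ isT).
have /andP[_ /b_gt0 b0] := uvE; rewrite mulf_eq0 gt_eqF //= sqrf_eq0 => /eqP->.
by rewrite mulr0 scale0r.
Qed.

(* Expand 0 <= (x - y)^T L (x - y) with L x = L' y = e_k and L <= L'. *)
Lemma inverse_diag_le z X k : reduced_laplacian E b z *m X = 1%:M ->
  invmx (full_laplacian E b) k k <= X k k.
Proof.
move=> LX; have Lf_unit := full_laplacian_unit _ _ LX.
set L := reduced_laplacian E b z in LX *; set Y := invmx _.
set e : 'cV[R]_N := delta_mx k 0; set x := X *m e; set y := Y *m e.
have Lx : L *m x = e by rewrite mulmxA LX mul1mx.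
have Ly : full_laplacian E b *m y = e by rewrite mulmxA mulmxV // mul1mx.
have symL : L^T = L := reduced_laplacian_tr _ _ _.
have trM00 (A B : 'cV[R]_N) : (A^T *m B) 0 0 = (B^T *m A) 0 0.
  by rewrite -[B in LHS]trmxK -trmx_mul mxE.
have entry (A : 'M[R]_N) : (e^T *m (A *m e)) 0 0 = A k k.
  by rewrite trmx_delta -rowE mxE -colE mxE.
have B00 (A B : 'M[R]_1) : (A - B) 0 0 = A 0 0 - B 0 0 by rewrite !mxE.
have xLy : (x^T *m (L *m y)) 0 0 = (e^T *m y) 0 0.
  by rewrite mulmxA -{1}symL -trmx_mul Lx.
have := reduced_laplacian_ge0 z (x - y); rewrite -/L mulmxBr Lx.
rewrite [(x - y)^T]linearB /= mulmxBl !mulmxBr !B00 xLy.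
have := reduced_laplacian_le_full z y; rewrite -/L Ly.
rewrite (trM00 x e) (trM00 y e) /x /y !entry; lra.
Qed.

End PositiveSusceptance.

(** * Diagonal entries of the inverse in a radial network *)

Section Radial.

Variables (E : {set {set node}}) (b : {set node} -> R) (z : {set node} -> bool).
Variable X : 'M[R]_N.
Hypotheses (sE : simple_graph E) (LX : reduced_laplacian E b z *m X = 1%:M).
Local Notation T := [set l in E | z l].
Hypothesis treeT : tree T.

(** Induction along the path: its first edge cuts the tree, so [node_entry_cut_diag] contributes one
    reactance per edge, down to the entry 0 at the reference. *)
Lemma tree_node_entry u p : simple_path T u ord0 p ->
  node_entry X u u = path_length b u p.
Proof.
have sT : simple_graph T by move=> l; rewrite inE => /andP[/sE].
elim: p u => [|v p IH] u.
  rewrite /simple_path /path_length big_nil => /and3P[_ /= /eqP-> _].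
  exact: node_entry0.
case/and3P=> /= /andP[uvT pT] lp /andP[up Up].
rewrite /path_length big_cons -/(path_length b v p) -IH; last exact/and3P.
have := uvT; rewrite /adj inE => /andP[uvE _].
have cut := tree_edge_cut _ _ _ sT treeT uvT.
pose S := [set s | connect (adj (T :\ [set u; v])) u s].
(* The tail avoids [u], so [v] stays on the reference side of the cut. *)
have v0 : connect (adj (T :\ [set u; v])) v ord0.
  by apply/connectP; exists p; rewrite ?(eqP lp) ?path_avoid.
have S0 : ord0 \notin S.
  rewrite inE; apply: contra cut => u0; apply: connect_trans u0 _.
  by rewrite (sym_connect_sym (@adj_sym _ _)).
have [|||||_ ->] := node_entry_cut_diag _ _ _ _ S u v LX S0; last exact: addrC.
- exact: adj_neq sT uvT.
- exact: uvE.
- move=> x y xyE zxy ne_l; apply: component_closed => //.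
  by rewrite inE xyE.
- by rewrite inE connect0.
by rewrite inE.
Qed.

End Radial.

End LaplacianTheory.

Theorem corollary1 (R : realFieldType) (N : nat)
    (E : {set {set 'I_N.+1}}) (b : {set 'I_N.+1} -> R)
    (hE : simple_graph E) (hconn : connected_graph E)
    (hb : forall l : {set 'I_N.+1}, l \in E -> 0 < b l)
    (i j : 'I_N) (Vl : {set 'I_N.+1})
    (hcrit : critical E [set lift ord0 i; lift ord0 j])
    (hcomp : components (E :\ [set lift ord0 i; lift ord0 j]) = [set Vl; ~: Vl])
    (hi : lift ord0 i \in Vl) (h1 : ord0 \in Vl) (hj : lift ord0 j \in ~: Vl)
    (z : {set 'I_N.+1} -> bool) (X : 'M[R]_N)
    (hX : reduced_laplacian E b z *m X = 1%:M) :
  forall eps : R, 0 < eps ->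
    (invmx (full_laplacian E b) i i + invmx (full_laplacian E b) j j
       - dist E b (lift ord0 i) (lift ord0 j) - eps) / 2 <= X i j
    /\ (tree [set l in E | z l] ->
        dist E b (lift ord0 i) ord0 - eps <= X i j).
Proof.
move=> eps eps_gt0; set ni := lift ord0 i; set nj := lift ord0 j.
have [ijE _] := hcrit.
have ne_ji : nj != ni by rewrite eq_sym; apply: adj_neq hE ijE.
have jiE : [set nj; ni] \in E by rewrite setUC.
have S0 : ord0 \notin ~: Vl by rewrite inE h1.
have Si : ni \notin ~: Vl by rewrite inE hi.
(* [~: Vl] is a connectivity class once the critical line is removed, so no other line leaves it,
   whatever the selection. *)
have cross z' : crossed_once E z' (~: Vl) nj ni.
  move=> x y xyE _; rewrite [[set nj; ni]]setUC => ne_l.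
  have xy : adj (E :\ [set ni; nj]) x y by rewrite /adj in_setD1 ne_l.
  have : ~: Vl \in components (E :\ [set ni; nj]) by rewrite hcomp set22.
  case/imsetP=> s _ ->; rewrite !inE /=.
  exact: (same_connect_r (sym_connect_sym (@adj_sym _ _)) (connect1 xy)).
have Lf_unit := full_laplacian_unit _ _ hb _ _ hX.
have := mulmxV Lf_unit; rewrite {1}full_laplacianE => hY.
(* The same cut serves both [X] and the inverse of the full Laplacian. The node [nj] plays the role
   of [u], being on the side away from the reference. *)
have diag z' Z (hZ : reduced_laplacian E b z' *m Z = 1%:M) :=
  node_entry_cut_diag _ _ _ _ _ _ _ hZ S0 ne_ji jiE (cross z') hj Si.
have [] := diag _ _ hX; rewrite !node_entry_lift => Xij _.
have [_] := diag _ _ hY; rewrite !node_entry_lift [[set nj; ni]]setUC => Yjj.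
split.
  (* The reactance cancels, leaving the diagonal entry of the full inverse at [i], minus [eps / 2],
     to be bounded by [X i i]. *)
  rewrite (dist_critical hE hconn hb hcrit) Yjj Xij.
  have := inverse_diag_le _ _ hb _ _ i hX; lra.
move=> treeT; have [cT _] := treeT.
have [p pT _] := dist_attained b (cT ni ord0).
have := tree_node_entry _ _ _ _ hE hX treeT _ _ pT; rewrite node_entry_lift -Xij => ->.
(* The tree path also lies in [E], so its length, which is [X i i], is at least the distance
   there. *)
have pE : simple_path E ni ord0 p.
  case/and3P: pT => pT lp Up; apply/and3P; split=> //.
  by apply: sub_path pT => x y; rewrite /adj inE => /andP[].
by have := dist_le b pE; lra.
Qed.
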